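(* (Fubini–Tonelli) Let $\mu:\mathcal P\to\mathbb R$ and $\nu:\mathcal Q\to\mathbb R$ be finite measures, where $\mathcal P$ is a semiring in a set $X$ and $\mathcal Q$ is a semiring in a set $Y$, and consider on $X\times Y$ the finite measure $\mu\times\nu$ on the semiring $\mathcal P\times\mathcal Q$. If $f\in R_2(X\times Y)$, then $$\int_{X\times Y}f(x,y)\,dx\,dy=\int_X\Bigl(\int_Y f(x,y)\,dy\Bigr)\,dx,$$ in the sense that $f(x,\cdot)\in R_2(Y)$ for almost every $x\in X$, the function $x\mapsto\int_Y f(x,y)\,dy$ belongs to $R_2(X)$, and the two sides are equal. (The integrals may be infinite.)
   Context: A semiring in a set $X$ is a family $\mathcal P\subset 2^X$ such that $\varnothing\in\mathcal P$; $P\cap Q\in\mathcal P$ for all $P,Q\in\mathcal P$; and for all $P,Q\in\mathcal P$ the set $P\setminus Q$ is a finite disjoint union of elements of $\mathcal P$. A finite measure on $\mathcal P$ is a function $\mu:\mathcal P\to[0,\infty)$ with $\mu(\varnothing)=0$ and $\mu(A)=\sum_{n=1}^\infty\mu(A_n)$ whenever $A\in\mathcal P$ is the disjoint union of a sequence $(A_n)\subset\mathcal P$. For a finite measure $\mu$ on a semiring $\mathcal P$ in $X$: a set $N\subset X$ is a null set if for each $\varepsilon>0$ there is a sequence $(P_n)\subset\mathcal P$ with $N\subset\bigcup P_n$ and $\sum\mu(P_n)<\varepsilon$; a property holds almost everywhere (a.e.) if it holds outside a null set. Functions (with values in $[-\infty,\infty]$, defined a.e.) that are equal a.e. are identified;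 $f_n\nearrow f$ means that $f_n\le f_{n+1}$ for all $n$ and $f_n\to f$, a.e. $R_0(X)$ is the vector space of step functions spanned by the characteristic functions $\chi_P$, $P\in\mathcal P$, with integral $\int\sum_{i=1}^n c_i\chi_{P_i}\,d\mu:=\sum_{i=1}^n c_i\mu(P_i)$ (independent of the representation). $R_1(X)$ is the class of functions $f:X\to[-\infty,\infty]$ for which there exists $(\varphi_n)\subset R_0(X)$ with $\varphi_n\nearrow f$, and then $\int f\,d\mu:=\lim\int\varphi_n\,d\mu\in(-\infty,\infty]$ (independent of $(\varphi_n)$). $R_2(X)$ is the class of functions which can be written (a.e.) as $f=f_1-f_2$ with $f_1,f_2\in R_1(X)$ such that at least one of $\int f_1\,d\mu$, $\int f_2\,d\mu$ is finite (then $f_1-f_2$ is defined a.e.); then $\int f\,d\mu:=\int f_1\,d\mu-\int f_2\,d\mu\in[-\infty,\infty]$ (independent of $f_1,f_2$). Given finite measures $\mu$ on $\mathcal P$ and $\nu$ on $\mathcal Q$, $\mathcal P\times\mathcal Q:=\{P\times Q: P\in\mathcal P,\ Q\in\mathcal Q\}$ is a semiring in $X\times Y$ and $(\mu\times\nu)(P\times Q):=\mu(P)\nu(Q)$ defines a finite measure on it. $R_i(X)$, $R_i(Y)$, $R_i(X\times Y)$ denote the classes $R_i$ for $\mu$, $\nu$, $\mu\times\nu$ respectively, and $dx$, $dy$, $dx\,dy$ stand for $d\mu$, $d\nu$, $d(\mu\times\nu)$. *)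

(* Defs.v *)
From mathcomp Require Import all_boot all_order all_algebra.
From mathcomp Require Import all_classical all_reals all_analysis.
Set Implicit Arguments.
Unset Strict Implicit.
Unset Printing Implicit Defensive.
Import Order.TTheory GRing.Theory Num.Theory.
Import numFieldNormedType.Exports.
Local Open Scope classical_set_scope.
Local Open Scope ring_scope.

Definition set_semiring (X : Type) (P : set (set X)) : Prop :=
  [/\ P set0, setI_closed P & semi_setD_closed P].

(* A measure on a family [P] of sets is a total function [mu : set X -> R];
   its values outside [P] are arbitrary, and no definition below reads them. *)
Definition finite_measure_on (R : realType) (X : Type) (P : set (set X))
    (mu : set X -> R) : Prop :=
  [/\ forall A, P A -> 0 <= mu A,
      mu set0 = 0 &
      forall A_ : nat -> set X, (forall n, P (A_ n)) -> trivIset setT A_ ->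
        P (\bigcup_n A_ n) ->
        (fun n => \sum_(0 <= i < n) mu (A_ i)) @ \oo --> mu (\bigcup_n A_ n)].

Section Integral.
Variables (R : realType) (X : Type) (P : set (set X)) (mu : set X -> R).

Definition null_on (N : set X) : Prop :=
  forall e : R, 0 < e -> exists P_ : nat -> set X,
    [/\ forall n, P (P_ n), N `<=` \bigcup_n P_ n &
        (\sum_(0 <= n <oo) (mu (P_ n))%:E < e%:E)%E].

Definition almost_every (Q : X -> Prop) : Prop :=
  exists2 N, null_on N & forall x, ~ N x -> Q x.

Definition increases_to (phi : nat -> X -> R) (f : X -> \bar R) : Prop :=
  almost_every (fun x => (forall n, phi n x <= phi n.+1 x) /\
                         (fun n => (phi n x)%:E) @ \oo --> f x).

Definition represents (n : nat) (c : 'I_n -> R) (A : 'I_n -> set X)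
    (phi : X -> R) : Prop :=
  (forall i, P (A i)) /\ forall x, phi x = \sum_(i < n) c i * \1_(A i) x.

Definition R0 (phi : X -> R) : Prop :=
  exists n (c : 'I_n -> R) (A : 'I_n -> set X), represents c A phi.

(* In [int_R0], [int_R1] and [int_R2], [xget 0] picks the value given
   by some representation of the function; the value does not depend on the
   representation when [mu] is a finite measure on the semiring [P], and it is
   the junk value 0 outside the corresponding class. *)
Definition int_R0 (phi : X -> R) : R :=
  xget 0 [set I | exists n (c : 'I_n -> R) (A : 'I_n -> set X),
    represents c A phi /\ I = \sum_(i < n) c i * mu (A i)].

Definition R1 (f : X -> \bar R) : Prop :=
  exists phi : nat -> X -> R, (forall n, R0 (phi n)) /\ increases_to phi f.

Definition int_R1 (f : X -> \bar R) : \bar R :=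
  xget 0%E [set I | exists phi : nat -> X -> R,
    [/\ forall n, R0 (phi n), increases_to phi f &
        (fun n => (int_R0 (phi n))%:E) @ \oo --> I]].

(* Functions defined a.e. are represented by total functions with arbitrary
   values elsewhere. The library's convention for oo - oo is harmless below: a
   function in [R1] is > -oo a.e., and is < +oo a.e. if its integral is finite,
   so [f1 x - f2 x] is a genuine difference for almost every [x]. *)
Definition difference_of (f f1 f2 : X -> \bar R) : Prop :=
  [/\ R1 f1, R1 f2,
      int_R1 f1 \is a fin_num \/ int_R1 f2 \is a fin_num &
      almost_every (fun x => f x = (f1 x - f2 x)%E)].

Definition R2 (f : X -> \bar R) : Prop := exists f1 f2, difference_of f f1 f2.

Definition int_R2 (f : X -> \bar R) : \bar R :=
  xget 0%E [set I | exists f1 f2, difference_of f f1 f2 /\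
                      I = (int_R1 f1 - int_R1 f2)%E].

End Integral.

Section Product.
Variables (R : realType) (X Y : Type).

Definition prod_family (P : set (set X)) (Q : set (set Y)) : set (set (X * Y)) :=
  [set A `*` B | A in P & B in Q].

(* The sides of a nonempty rectangle are its projections; if a rectangle is
   empty, so are its projections, and the formula gives 0. *)
Definition prod_measure (mu : set X -> R) (nu : set Y -> R)
    (E : set (X * Y)) : R :=
  mu (fst @` E) * nu (snd @` E).

Lemma prod_measureE (mu : set X -> R) (nu : set Y -> R) (A : set X) (B : set Y) :
  mu set0 = 0 -> nu set0 = 0 -> prod_measure mu nu (A `*` B) = mu A * nu B.
Proof.
move=> mu0 nu0; rewrite /prod_measure.
have [->|/set0P[a Aa]] := eqVneq A set0.
  by rewrite set0X image_set0 mu0 !mul0r.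
have [->|/set0P[b Bb]] := eqVneq B set0.
  by rewrite setX0 image_set0 image_set0 nu0 !mulr0.
congr (mu _ * nu _); apply/seteqP; split.
- by move=> _ [[x y] [/= Ax By] <-].
- by move=> x Ax; exists (x, b).
- by move=> _ [[x y] [/= Ax By] <-].
- by move=> y By; exists (a, y).
Qed.

End Product.

(* Main.v *)
Require Import Defs.
From HB Require Import structures.
From mathcomp Require Import all_boot all_order all_algebra.
From mathcomp Require Import all_classical all_reals all_analysis.
From mathcomp Require Import measurable_realfun lra.

(** The Caratheodory extension of a finite measure on a semiring has exactly the
    null sets of the semiring, so its Lebesgue integral computes [int_R0] and,
    by monotone convergence, [int_R1]; hence these integrals do not depend on
    the chosen representations, and neither does [int_R2], since
    [f1 - f2 = g1 - g2] amounts to [f1 + g2 = g1 + f2] and the integral is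
    additive on R1. On the product, Fubini's theorem is obvious for step
    functions. Almost every section of a null set is null (Borel-Cantelli), so
    an increasing sequence of step functions stays so on almost every section,
    which gives the theorem on R1 by passing to the limit, and then on R2 by
    subtraction. *)

Set Implicit Arguments.
Unset Strict Implicit.
Unset Printing Implicit Defensive.
Import Order.TTheory GRing.Theory Num.Theory.
Import numFieldNormedType.Exports.
Local Open Scope classical_set_scope.
Local Open Scope ring_scope.

(** * Monotone convergence almost everywhere, for a complete measure *)

Lemma cvg_maxe0 (R : realType) (u : nat -> \bar R) (l : \bar R) :
  u @ \oo --> l -> (fun n => maxe (u n) 0%E) @ \oo --> maxe l 0%E.
Proof.
move=> ul.
exact: (cvg_comp _ _ (cvg_pair ul (cvg_cst 0%E))
  (@max_continuous _ (\bar R) (l, 0%E))).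
Qed.

Section complete_measure.
Context d (T : measurableType d) (R : realType) (m : {measure set T -> \bar R}).
Hypothesis m_complete : measure_is_complete m.
Local Open Scope ereal_scope.

Lemma integral_setD_null (N : set T) (f : T -> \bar R) :
  measurable N -> m N = 0 -> measurable_fun setT f ->
  \int[m]_x f x = \int[m]_(x in ~` N) f x.
Proof.
move=> mN N0 mf; rewrite -setTD integralE [RHS]integralE.
by congr (_ - _); apply: ge0_negligible_integral => //;
  [exact: measurable_funepos|exact: measurable_funeneg].
Qed.

Lemma ae_le_integral (f g : T -> \bar R) :
  m.-integrable setT f -> m.-integrable setT g ->
  (\forall x \ae m, f x <= g x) -> \int[m]_x f x <= \int[m]_x g x.
Proof.
move=> intf intg [N [mN N0 fg]].
rewrite (integral_setD_null mN N0 (measurable_int _ intf)).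
rewrite (integral_setD_null mN N0 (measurable_int _ intg)).
have mNC : measurable (~` N) by exact: measurableC.
apply: le_integral => //; [exact: integrableS intf|exact: integrableS intg|].
by move=> x /set_mem Nx; apply: contrapT => h; apply: Nx; exact: fg.
Qed.

Variables (phi : nat -> T -> R) (f : T -> \bar R).
Hypothesis phi_int : forall n, m.-integrable setT (EFin \o phi n).
Hypothesis phi_f : \forall x \ae m, (forall n, (phi n x <= phi n.+1 x)%R) /\
  (fun n => (phi n x)%:E) @ \oo --> f x.

(** The [phi n] may change sign: monotone convergence applies to the positive parts, which increase,
    and dominated convergence to the negative parts, which are bounded a.e. by that of [phi 0]. *)
Lemma ae_nondecreasing_cvg_integral :
  (fun n => \int[m]_x (phi n x)%:E) @ \oo --> \int[m]_x f x /\
  (\int[m]_x f x < +oo -> \forall x \ae m, f x < +oo).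
Proof.
have [N [mN N0 phiN]] := phi_f.
pose D := ~` N.
have mD : measurable D by exact: measurableC.
have phiD x : D x -> (forall n, (phi n x <= phi n.+1 x)%R) /\
    (fun n => (phi n x)%:E) @ \oo --> f x.
  by move=> Dx; apply: contrapT => h; apply: Dx; exact: phiN.
have ndD x : D x -> {homo (fun n => phi n x) : i j / (i <= j)%N >-> (i <= j)%R}.
  by move=> Dx; apply/nondecreasing_seqP => n; apply: (phiD _ Dx).1.
have mphi n : measurable_fun setT (EFin \o phi n).
  by exact: measurable_int (phi_int n).
have mphiD n : measurable_fun D (EFin \o phi n) by exact: measurable_funTS.
have mfD : measurable_fun D f.
  apply: (@emeasurable_fun_cvg _ _ _ _ (fun n => EFin \o phi n)) => //.
  by move=> x /phiD[].
(* Off [D] nothing is known of [f]; completeness of [m] makes [f] measurable because it agrees a.e.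
   with [f \_ D]. *)
have mf : measurable_fun setT f.
  apply: (@ae_measurable_fun _ _ _ m m_complete setT (f \_ D)).
    exists N; split => // x /= h; apply: contrapT => Nx; apply: h => _.
    by rewrite patchE mem_set.
  by apply/(measurable_restrictT f mD).
have phi0int : m.-integrable D (EFin \o phi 0%N)^\-.
  by apply: integrable_funeneg => //; apply: (integrableS measurableT).
have fneg x : D x -> f^\- x <= (EFin \o phi 0%N)^\- x.
  move=> Dx; rewrite !funenegE; apply: le_max2 => //; rewrite leeN2.
  have [_ /cvg_lim <-//] := phiD _ Dx; apply: lime_ge.
    by apply/cvg_ex; exists (f x); apply: (phiD _ Dx).2.
  by apply: nearW => n; rewrite lee_fin; exact: ndD.
have fnegint : m.-integrable D f^\-.
  apply: le_integrable phi0int => //.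
    exact: measurable_funeneg.
  by move=> x Dx; rewrite !gee0_abs// ?fneg// funeneg_ge0.
have cvgp : (fun n => \int[m]_(x in D) (EFin \o phi n)^\+ x) @ \oo -->
    \int[m]_(x in D) f^\+ x.
  rewrite (_ : \int[m]_(x in D) f^\+ x =
    \int[m]_(x in D) limn (fun n => (EFin \o phi n)^\+ x)); last first.
    apply: eq_integral => x /set_mem Dx; apply/esym/cvg_lim => //.
    rewrite funeposE; under eq_fun do rewrite funeposE.
    by apply: cvg_maxe0; apply: (phiD _ Dx).2.
  apply: cvg_monotone_convergence => //.
  - by move=> n; exact: measurable_funepos.
  - move=> x Dx i j ij; rewrite !funeposE; apply: le_max2 => //=.
    by rewrite lee_fin; exact: ndD.
have cvgn : (fun n => \int[m]_(x in D) (EFin \o phi n)^\- x) @ \oo -->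
    \int[m]_(x in D) f^\- x.
  have [] := @dominated_convergence _ _ _ m D mD (fun n => (EFin \o phi n)^\-)
    f^\- (EFin \o phi 0%N)^\- => //.
  - by move=> n; exact: measurable_funeneg.
  - exact: measurable_funeneg.
  - apply: aeW => x Dx; rewrite funenegE; under eq_fun do rewrite funenegE.
    apply: cvg_maxe0; apply: cvgeN.
    exact: (phiD _ Dx).2.
  - apply: aeW => x n Dx; rewrite gee0_abs ?funeneg_ge0//.
    rewrite !funenegE; apply: le_max2 => //=; rewrite lee_fin lerN2.
    exact: ndD.
(* This excludes [oo - oo] when the two limits are subtracted. *)
have fnfin : \int[m]_(x in D) f^\- x \is a fin_num.
  have -> : \int[m]_(x in D) f^\- x = \int[m]_(x in D) f^\-^\+ x.
    apply: eq_integral => x _; rewrite funeposE; apply/esym/max_idPl.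
    exact: funeneg_ge0.
  exact: integrable_pos_fin_num.
split.
  rewrite (integral_setD_null mN N0 mf) [X in _ --> X]integralE.
  under eq_fun => n do
    rewrite (integral_setD_null mN N0 (mphi n)) integralE.
  by apply: cvgeB => //; rewrite fin_num_adde_defl// fin_numN.
(* As [f^\-] has a finite integral, [foo] bounds the integral of [f^\+], and an integrable function
   is finite a.e. *)
rewrite (integral_setD_null mN N0 mf) integralE => foo.
have fpoo : \int[m]_(x in D) f^\+ x < +oo.
  rewrite -(subeK (\int[m]_(x in D) f^\+ x) fnfin).
  by rewrite lte_add_pinfty// ltey_eq fnfin.
have fpint : m.-integrable D f^\+.
  apply/integrableP; split; first exact: measurable_funepos.
  by under eq_integral => x _ do rewrite gee0_abs ?funepos_ge0//.
have aefin := integrable_ae mD fpint.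
have aeD : \forall x \ae m, D x by exists N; split => // x /contrapT.
apply: filterS2 aefin aeD => x /[apply].
rewrite funeposE => h; rewrite ltey; apply/eqP => fx.
by move: h; rewrite fx max_l ?leey.
Qed.

End complete_measure.

(** * Step functions and the Caratheodory extension of a measure on a semiring *)

Lemma integral_step d (T : measurableType d) (R : realType)
    (m : {measure set T -> \bar R}) n (c : 'I_n -> R) (A : 'I_n -> set T) :
  (forall i, measurable (A i)) -> (forall i, m (A i) < +oo)%E ->
  m.-integrable setT (fun x => (\sum_(i < n) c i * \1_(A i) x)%:E) /\
  (\int[m]_x (\sum_(i < n) c i * \1_(A i) x)%:E =
   \sum_(i < n) (c i)%:E * m (A i))%E.
Proof.
move=> mA Aoo.
have iA i : m.-integrable setT (fun x => (\1_(A i) x)%:E).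
  apply/integrableP; split; first exact/measurable_EFinP.
  rewrite (eq_integral (fun x => (\1_(A i) x)%:E)); last first.
    by move=> x _; rewrite gee0_abs ?lee_fin.
  by rewrite integral_indic// setIT.
have icA i : m.-integrable setT (fun x => (c i)%:E * (\1_(A i) x)%:E)%E.
  exact: integrableZl.
have E : (fun x => (\sum_(i < n) c i * \1_(A i) x)%:E) =
    (fun x => (\sum_(i < n) (c i)%:E * (\1_(A i) x)%:E)%E).
  by apply/funext => x; rewrite -sumEFin.
rewrite E; split; first exact: integrable_sum.
rewrite integral_sum//; apply: eq_bigr => i _.
by rewrite integralZl// integral_indic// setIT.
Qed.

Section semiring_space.
Variables (X : Type) (P : set (set X)) (semP : set_semiring P) (x0 : X).

(* The hypothesis [semP] and the point [x0] are parameters of the type so that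
   it can carry the library's (pointed) semiring structure. *)
Definition semiring_space of set_semiring P & X : Type := X.
Notation T := (semiring_space semP x0).

HB.instance Definition _ := gen_eqMixin T.
HB.instance Definition _ := gen_choiceMixin T.
HB.instance Definition _ := isPointed.Build T x0.

Let P0 : P set0. Proof. by case: semP. Qed.
Let PI : setI_closed P. Proof. by case: semP. Qed.
Let PD : semi_setD_closed P. Proof. by case: semP. Qed.

HB.instance Definition _ :=
  @isSemiRingOfSets.Build default_measure_display T P P0 PI PD.

Variables (R : realType) (mu : set X -> R).
Hypothesis mu_fin : finite_measure_on P mu.

(* [mu] may be negative outside [P], whence the absolute value. *)
Definition premeasure of finite_measure_on P mu : set T -> \bar R :=
  fun A => `|mu A|%:E.

Lemma premeasureE A : P A -> premeasure mu_fin A = (mu A)%:E.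
Proof.
by have [mu_ge0 _ _] := mu_fin => PA; rewrite /premeasure ger0_norm ?mu_ge0.
Qed.

Let premeasure0 : premeasure mu_fin set0 = 0%E.
Proof. by have [? mu0 _] := mu_fin; rewrite /premeasure mu0 normr0. Qed.

Let premeasure_ge0 A : (0 <= premeasure mu_fin A)%E.
Proof. by rewrite lee_fin. Qed.

Let premeasure_sigma_additive : semi_sigma_additive (premeasure mu_fin).
Proof.
move=> F mF tF mUF; rewrite premeasureE//.
have E n : \sum_(0 <= i < n) premeasure mu_fin (F i) =
    (\sum_(0 <= i < n) mu (F i))%:E.
  by rewrite -sumEFin; apply: eq_bigr => i _; exact/premeasureE/mF.
under eq_fun do rewrite E.
apply: cvg_EFin; first by apply: nearW.
by have [_ _] := mu_fin; apply.
Qed.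

HB.instance Definition _ := isMeasure.Build _ T R (premeasure mu_fin)
  premeasure0 premeasure_ge0 premeasure_sigma_additive.

Local Notation ext := ((premeasure mu_fin)^*)%mu.
Local Notation U := (caratheodory_type ext).

Local Notation m := (@completed_measure_extension _ _ _ (premeasure mu_fin)).

(** The covers in [null_on] are those of the infimum that defines the outer measure. *)
Lemma null_onE N : null_on P mu N <-> ext N = 0%E.
Proof.
split=> [Nnull|N0].
  apply/eqP; rewrite eq_le outer_measure_ge0 andbT.
  apply/lee_addgt0Pr => e e0; rewrite add0e.
  have [F [PF NF Fe]] := Nnull _ e0.
  apply: le_trans (ltW Fe); apply: ereal_inf_lbound; exists F => //.
  by apply: eq_eseriesr => n _; exact: premeasureE.
move=> e e0.
have : (ext N < e%:E)%E by rewrite N0 lte_fin.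
move=> /ereal_inf_lt[_ [F [PF NF] <-] Fe]; exists F; split => //.
rewrite (@eq_eseriesr _ _ (fun n => premeasure mu_fin (F n))) // => n _.
exact/esym/premeasureE/PF.
Qed.

(** A set of outer measure zero satisfies the Caratheodory criterion, so it is measurable and the
    two notions of negligible set coincide. *)
Lemma almost_everyE Q : almost_every P mu Q <-> \forall x \ae m, Q x.
Proof.
split=> [[N /null_onE N0 NQ]|[N [mN N0 NQ]]].
  have mN : measurable (N : set U).
    apply: le_caratheodory_measurable => A; rewrite -[leRHS]add0e leeD//.
      by rewrite -[leRHS]N0; apply: le_outer_measure; exact: subIsetr.
    by apply: le_outer_measure; exact: subIsetl.
  by exists N; split => // x /= nQ; apply: contrapT => /NQ.
exists N; first exact/null_onE.
by move=> x Nx; apply: contrapT => nQ; apply: Nx; exact: NQ.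
Qed.

(** Members of [P] keep their measure in the extension. The integral on the left does not see the
    representation, hence neither does the sum on the right. *)
Lemma represents_integral n (c : 'I_n -> R) A phi : represents P c A phi ->
  m.-integrable setT (EFin \o phi) /\
  (\int[m]_x (phi x)%:E = (\sum_(i < n) c i * mu (A i))%:E)%E.
Proof.
move=> [PA /funext ->].
have mA i : measurable (A i : set U).
  exact: caratheodory_measurable_mu_ext (PA i).
have muA i : m (A i) = (mu (A i))%:E.
  by rewrite -premeasureE//; apply: measurable_mu_extE; exact: PA.
have Aoo i : (m (A i) < +oo)%E by rewrite muA ltry.
have [iphi Iphi] := integral_step c mA Aoo.
split=> //; rewrite [LHS]Iphi -sumEFin; apply: eq_bigr => i _.
by rewrite EFinM; congr (_ * _)%E; exact: muA.
Qed.

End semiring_space.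

(** * Almost everywhere properties, and the integral as an abstract functional *)

Section integral_functional.
Variables (R : realType) (X : Type) (P : set (set X)) (mu : set X -> R).
Hypotheses (semP : set_semiring P) (mu_fin : finite_measure_on P mu).

Lemma null_on0 : null_on P mu set0.
Proof.
have [P0 _ _] := semP; have [_ mu0 _] := mu_fin.
move=> e e0; exists (fun=> set0); split=> //.
by rewrite eseries0 ?lte_fin// => n _ _; rewrite mu0.
Qed.

Lemma almost_everyW (Q : X -> Prop) : (forall x, Q x) -> almost_every P mu Q.
Proof. by exists set0 => //; exact: null_on0. Qed.

Lemma almost_everyS (Q S : X -> Prop) : (forall x, Q x -> S x) ->
  almost_every P mu Q -> almost_every P mu S.
Proof. by move=> QS [N N0 NQ]; exists N => // x /NQ /QS. Qed.

Lemma almost_every_forall (Q : nat -> X -> Prop) :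
  (forall n, almost_every P mu (Q n)) ->
  almost_every P mu (fun x => forall n, Q n x).
Proof.
(* The extension lives on a pointed type; over an empty [X] everything holds everywhere. *)
move=> aeQ; have [[x0]|X0] := pselect (inhabited X); last first.
  by apply: almost_everyW => x; case: X0.
apply/(almost_everyE semP x0 mu_fin)/ae_foralln => n.
exact/(almost_everyE semP x0 mu_fin).
Qed.

Lemma almost_everyI (Q S : X -> Prop) : almost_every P mu Q ->
  almost_every P mu S -> almost_every P mu (fun x => Q x /\ S x).
Proof.
move=> aeQ aeS.
have : almost_every P mu (fun x => forall n, (if n is 0%N then Q else S) x).
  by apply: almost_every_forall => -[].
by apply: almost_everyS => x QS; split; [exact: (QS 0%N)|exact: (QS 1%N)].
Qed.

(** Retains from the Lebesgue integral of the extension only what the sequel uses, without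
    mentioning a base point, so that an empty [X] is covered too. *)
Lemma integral_functional : exists I : (X -> \bar R) -> \bar R,
  [/\ forall n (c : 'I_n -> R) A phi, represents P c A phi ->
        I (EFin \o phi) = (\sum_(i < n) c i * mu (A i))%:E,
      forall phi f, (forall n, R0 P (phi n)) -> increases_to P mu phi f ->
        (fun n => I (EFin \o phi n)) @ \oo --> I f,
      forall phi f, (forall n, R0 P (phi n)) -> increases_to P mu phi f ->
        (I f < +oo)%E -> almost_every P mu (fun x => (f x < +oo)%E) &
      forall phi psi : X -> R, R0 P phi -> R0 P psi ->
        almost_every P mu (fun x => phi x <= psi x) ->
        (I (EFin \o phi) <= I (EFin \o psi))%E].
Proof.
have [[x0]|X0] := pselect (inhabited X); last first.
  exists (fun=> 0%E); split => //.
  - move=> n c A phi _; rewrite big1// => i _.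
    rewrite (_ : A i = set0); last by apply/seteqP; split => // x; case: X0.
    by have [_ -> _] := mu_fin; rewrite mulr0.
  - by move=> *; exact: cvg_cst.
  - by move=> *; apply: almost_everyW => x; case: X0.
pose mu' := @premeasure X P semP x0 R mu mu_fin.
pose m := @completed_measure_extension _ (semiring_space semP x0) _ mu'.
have m_complete : measure_is_complete m.
  by exact: measure_is_complete_caratheodory.
have R0int phi : R0 P phi -> m.-integrable setT (EFin \o phi).
  by move=> [n [c [A /(represents_integral semP x0 mu_fin)[]]]].
exists (fun f => (\int[m]_x f x)%E); split.
- by move=> n c A phi /(represents_integral semP x0 mu_fin)[].
- move=> phi f R0phi /(almost_everyE semP x0 mu_fin) phif.
  have iphi n := R0int _ (R0phi n).
  by have [] := ae_nondecreasing_cvg_integral m_complete iphi phif.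
- move=> phi f R0phi /(almost_everyE semP x0 mu_fin) phif foo.
  have iphi n := R0int _ (R0phi n).
  have [_ h] := ae_nondecreasing_cvg_integral m_complete iphi phif.
  exact/(almost_everyE semP x0 mu_fin)/h.
- move=> phi psi /R0int iphi /R0int ipsi /(almost_everyE semP x0 mu_fin).
  by move=> phipsi; exact: ae_le_integral iphi ipsi phipsi.
Qed.

End integral_functional.

(** Applied below both to values of functions and to integrals. The hypotheses rule out [oo - oo] on
    either side, which leaves a check of cases. *)
Lemma sube_eq_adde (R : realType) (x1 x2 y1 y2 : \bar R) :
  (-oo < x1 -> -oo < x2 -> -oo < y1 -> -oo < y2 ->
   x1 < +oo \/ x2 < +oo -> y1 < +oo \/ y2 < +oo ->
   x1 - x2 = y1 - y2 <-> x1 + y2 = y1 + x2)%E.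
Proof.
case: x1 x2 y1 y2 => [r1||] [r2||] [s1||] [s2||] //= _ _ _ _;
  rewrite ?ltxx => -[]// _ -[]// _.
all: by split=> -[h]; congr (_%:E); lra.
Qed.

(** * The integrals on R0, R1 and R2: well-definedness and additivity *)

Section semiring_integral.
Variables (R : realType) (X : Type) (P : set (set X)) (mu : set X -> R).
Hypotheses (semP : set_semiring P) (mu_fin : finite_measure_on P mu).
Local Notation ae := (almost_every P mu).

(** Every representation yields the value of the functional at [phi], so [xget] picks from a
    singleton. *)
Lemma int_R0E n (c : 'I_n -> R) A phi : represents P c A phi ->
  int_R0 P mu phi = \sum_(i < n) c i * mu (A i).
Proof.
move=> phiE; have [I [I0 _ _ _]] := integral_functional semP mu_fin.
apply: xget_subset1; first by exists n, c, A.
move=> _ _ [n1 [c1 [A1 [phi1 ->]]]] [n2 [c2 [A2 [phi2 ->]]]].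
by apply: EFin_inj; rewrite -(I0 _ _ _ _ phi1) -(I0 _ _ _ _ phi2).
Qed.

Lemma R0_lincomb n (c : 'I_n -> R) A phi : represents P c A phi -> R0 P phi.
Proof. by move=> phiE; exists n, c, A. Qed.

Lemma represents_add n1 (c1 : 'I_n1 -> R) A1 phi1 n2 (c2 : 'I_n2 -> R) A2 phi2 :
  represents P c1 A1 phi1 -> represents P c2 A2 phi2 ->
  represents P
    (fun i : 'I_(n1 + n2) =>
       match fintype.split i with inl j => c1 j | inr k => c2 k end)
    (fun i : 'I_(n1 + n2) =>
       match fintype.split i with inl j => A1 j | inr k => A2 k end)
    (phi1 \+ phi2).
Proof.
move=> [PA1 phi1E] [PA2 phi2E]; split=> [i|x]; first by case: fintype.split.
rewrite /= phi1E phi2E big_split_ord /=; congr (_ + _); apply: eq_bigr => i _.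
  by rewrite -[lshift _ _]/(unsplit (inl i)) unsplitK.
by rewrite -[rshift _ _]/(unsplit (inr i)) unsplitK.
Qed.

Lemma R0D (phi psi : X -> R) : R0 P phi -> R0 P psi -> R0 P (phi \+ psi).
Proof.
move=> [n1 [c1 [A1 phi1]]] [n2 [c2 [A2 phi2]]].
by exists (n1 + n2)%N; do 2 eexists; exact: represents_add phi1 phi2.
Qed.

Lemma int_R0D phi psi : R0 P phi -> R0 P psi ->
  int_R0 P mu (phi \+ psi) = int_R0 P mu phi + int_R0 P mu psi.
Proof.
move=> [n1 [c1 [A1 phi1]]] [n2 [c2 [A2 phi2]]].
rewrite (int_R0E (represents_add phi1 phi2)) (int_R0E phi1) (int_R0E phi2).
rewrite big_split_ord /=; congr (_ + _); apply: eq_bigr => i _.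
  by rewrite -[lshift _ _]/(unsplit (inl i)) unsplitK.
by rewrite -[rshift _ _]/(unsplit (inr i)) unsplitK.
Qed.

(** Along any sequence of step functions increasing to [f] the integrals tend to [I f], so the set
    from which [int_R1] picks is a singleton. *)
Lemma integral_R1 : exists I : (X -> \bar R) -> \bar R,
  [/\ forall phi : X -> R, R0 P phi -> I (EFin \o phi) = (int_R0 P mu phi)%:E,
      forall f, R1 P mu f -> int_R1 P mu f = I f,
      forall phi f, (forall n, R0 P (phi n)) -> increases_to P mu phi f ->
        (fun n => (int_R0 P mu (phi n))%:E) @ \oo --> I f,
      forall f, R1 P mu f -> (I f < +oo)%E -> ae (fun x => (f x < +oo)%E) &
      forall phi psi : X -> R, R0 P phi -> R0 P psi ->
        ae (fun x => phi x <= psi x) ->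
        int_R0 P mu phi <= int_R0 P mu psi].
Proof.
have [I [I0 I1 I2 Ile]] := integral_functional semP mu_fin.
have IE phi : R0 P phi -> I (EFin \o phi) = (int_R0 P mu phi)%:E.
  by move=> [n [c [A phiE]]]; rewrite (int_R0E phiE) (I0 _ _ _ _ phiE).
have Icvg phi f : (forall n, R0 P (phi n)) -> increases_to P mu phi f ->
    (fun n => (int_R0 P mu (phi n))%:E) @ \oo --> I f.
  move=> R0phi phif; under eq_fun => n do rewrite -IE//.
  exact: I1.
exists I; split => //.
- move=> f [phi [R0phi phif]]; apply: xget_subset1.
    by exists phi; split => //; exact: Icvg.
  have lim1 J : (exists phi, [/\ forall n, R0 P (phi n),
      increases_to P mu phi f &
      (fun n => (int_R0 P mu (phi n))%:E) @ \oo --> J]) -> J = I f.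
    move=> [psi [R0psi psif /cvg_lim <-//]].
    by apply/cvg_lim => //; exact: Icvg.
  by move=> _ _ /lim1 -> /lim1 ->.
- by move=> f [phi [R0phi phif]]; exact: I2 phif.
- by move=> phi psi R0phi R0psi /(Ile _ _ R0phi R0psi); rewrite !IE// lee_fin.
Qed.

Lemma le_int_R0 phi psi : R0 P phi -> R0 P psi ->
  ae (fun x => phi x <= psi x) ->
  int_R0 P mu phi <= int_R0 P mu psi.
Proof. by have [I [_ _ _ _]] := integral_R1; exact. Qed.

Lemma int_R1_cvg phi f : (forall n, R0 P (phi n)) -> increases_to P mu phi f ->
  (fun n => (int_R0 P mu (phi n))%:E) @ \oo --> int_R1 P mu f.
Proof.
move=> R0phi phif; have [I [_ IE Icvg _ _]] := integral_R1.
by rewrite IE; [exact: Icvg|exists phi].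
Qed.

Lemma R1_lty f : R1 P mu f -> (int_R1 P mu f < +oo)%E ->
  ae (fun x => (f x < +oo)%E).
Proof.
have [I [_ IE _ Ioo _]] := integral_R1.
by move=> R1f; rewrite IE//; exact: Ioo.
Qed.

Lemma R1_gtNy f : R1 P mu f -> ae (fun x => (-oo < f x)%E).
Proof.
move=> [phi [_ phif]]; apply: almost_everyS phif => x [ndphi phif].
apply: (@lt_le_trans _ _ (phi 0%N x)%:E); first exact: ltNyr.
rewrite -(cvg_lim _ phif)//; apply: lime_ge.
  by apply/cvg_ex; exists (f x).
by apply: nearW => n; rewrite lee_fin; elim: n => // n /le_trans; apply.
Qed.

Lemma int_R1_ge phi f : (forall n, R0 P (phi n)) -> increases_to P mu phi f ->
  forall n, ((int_R0 P mu (phi n))%:E <= int_R1 P mu f)%E.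
Proof.
move=> R0phi phif n; have Icvg := int_R1_cvg R0phi phif.
rewrite -(cvg_lim _ Icvg)//; apply: lime_ge.
  by apply/cvg_ex; eexists; exact: Icvg.
exists n => // k /= nk; rewrite lee_fin; apply: le_int_R0 => //.
apply: almost_everyS phif => x [/nondecreasing_seqP ndphi _].
exact: ndphi.
Qed.

Lemma int_R1_gtNy f : R1 P mu f -> (-oo < int_R1 P mu f)%E.
Proof.
move=> [phi [R0phi phif]].
by apply: lt_le_trans (int_R1_ge R0phi phif 0); rewrite ltNyr.
Qed.

Lemma R1_ae_eq f g : R1 P mu f -> ae (fun x => f x = g x) ->
  R1 P mu g /\ int_R1 P mu g = int_R1 P mu f.
Proof.
move=> [phi [R0phi phif]] fg.
have phig : increases_to P mu phi g.
  by apply: almost_everyS (almost_everyI semP mu_fin phif fg) => x [+ <-].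
split; first by exists phi.
rewrite -(cvg_lim _ (int_R1_cvg R0phi phig))//.
by rewrite (cvg_lim _ (int_R1_cvg R0phi phif)).
Qed.

Lemma R1D f g : R1 P mu f -> R1 P mu g -> R1 P mu (f \+ g)%E /\
  int_R1 P mu (f \+ g)%E = (int_R1 P mu f + int_R1 P mu g)%E.
Proof.
move=> R1f R1g; have := (R1_gtNy R1f, R1_gtNy R1g).
have := (int_R1_gtNy R1f, int_R1_gtNy R1g).
case: R1f R1g => [phi [R0phi phif]] [psi [R0psi psig]] [If Ig] [fNy gNy].
(* Members of R1 exceed [-oo] a.e. and their integrals exceed it too, so no [oo - oo] occurs and
   limits can be added. *)
have add_def (a b : \bar R) : (-oo < a -> -oo < b -> a +? b)%E.
  by case: a b => [?||] [?||].
have R0D n : R0 P (phi n \+ psi n) by exact: R0D.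
have fg : increases_to P mu (fun n => phi n \+ psi n) (f \+ g)%E.
  have := almost_everyI semP mu_fin (almost_everyI semP mu_fin phif psig)
    (almost_everyI semP mu_fin fNy gNy).
  apply: almost_everyS => x [[[ndphi phif'] [ndpsi psig']] [fx gx]].
  split; first by move=> n; rewrite lerD.
  exact: (cvgeD (add_def _ _ fx gx) phif' psig').
split; first by exists (fun n => phi n \+ psi n).
rewrite -(cvg_lim _ (int_R1_cvg R0D fg))//; apply/cvg_lim => //.
under eq_fun => n do rewrite int_R0D// EFinD.
exact: (cvgeD (add_def _ _ If Ig) (int_R1_cvg R0phi phif)
  (int_R1_cvg R0psi psig)).
Qed.

(** Gathers the conditions under which [sube_eq_adde] applies pointwise; whichever of the two
    integrals is finite gives a function below [+oo] a.e. *)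
Lemma difference_of_fin f f1 f2 : difference_of P mu f f1 f2 ->
  ae (fun x => [/\ -oo < f1 x, -oo < f2 x, f1 x < +oo \/ f2 x < +oo &
    f x = f1 x - f2 x]%E).
Proof.
move=> [R1f1 R1f2 fin ff].
have fin' : ae (fun x => f1 x < +oo \/ f2 x < +oo)%E.
  case: fin => /fin_numPlt/andP[_ foo].
    by apply: almost_everyS (R1_lty R1f1 foo); left.
  by apply: almost_everyS (R1_lty R1f2 foo); right.
have := almost_everyI semP mu_fin (almost_everyI semP mu_fin fin' ff)
  (almost_everyI semP mu_fin (R1_gtNy R1f1) (R1_gtNy R1f2)).
by apply: almost_everyS => x [[? ?] []].
Qed.

Lemma int_R2E f f1 f2 : difference_of P mu f f1 f2 ->
  int_R2 P mu f = (int_R1 P mu f1 - int_R1 P mu f2)%E.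
Proof.
move=> fE; apply: xget_subset1; first by exists f1, f2.
move=> _ _ [g1 [g2 [gE ->]]] [h1 [h2 [hE ->]]].
have := almost_everyI semP mu_fin (difference_of_fin gE) (difference_of_fin hE).
case: gE hE => [R1g1 R1g2 ging _] [R1h1 R1h2 hinh _] gh.
(* Differences become sums, which stay in R1 and have additive integrals. *)
have {}gh : ae (fun x => (g1 \+ h2) x = (h1 \+ g2) x)%E.
  apply: almost_everyS gh => x [[g1x g2x gx fg] [h1x h2x hx fh]].
  by apply: (sube_eq_adde g1x g2x h1x h2x gx hx).1; rewrite -fg.
have [R1gh Igh] := R1D R1g1 R1h2; have [R1hg Ihg] := R1D R1h1 R1g2.
have [_] := R1_ae_eq R1gh gh; rewrite Igh Ihg => Igh'.
(* The integrals meet the same conditions as the values, so the sums turn back into differences. *)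
apply: (sube_eq_adde _ _ _ _ _ _).2; rewrite ?int_R1_gtNy//.
- by case: ging => /fin_numPlt/andP[_ ->]; [left|right].
- by case: hinh => /fin_numPlt/andP[_ ->]; [left|right].
Qed.

End semiring_integral.

(** * Sums of step functions, and step functions as members of R1 *)

Section step_functions.
Variables (R : realType) (X : Type) (P : set (set X)) (mu : set X -> R).
Hypotheses (semP : set_semiring P) (mu_fin : finite_measure_on P mu).

Lemma R0_sum (g : nat -> X -> R) n : (forall i, R0 P (g i)) ->
  R0 P (fun x => \sum_(0 <= i < n) g i x) /\
  int_R0 P mu (fun x => \sum_(0 <= i < n) g i x) =
  \sum_(0 <= i < n) int_R0 P mu (g i).
Proof.
move=> R0g; elim: n => [|n [IHR IHi]].
  have rep : represents P (fun=> 0 : R) (fun _ : 'I_0 => set0)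
      (fun x => \sum_(0 <= i < 0) g i x).
    by split=> [[]//|x]; rewrite big_nil big_ord0.
  split; first exact: R0_lincomb rep.
  by rewrite (int_R0E _ _ rep)// big_nil big_ord0.
have -> : (fun x => \sum_(0 <= i < n.+1) g i x) =
    ((fun x => \sum_(0 <= i < n) g i x) \+ g n).
  by apply/funext => x; rewrite big_nat_recr.
split; first exact: R0D.
by rewrite int_R0D// IHi big_nat_recr.
Qed.

Lemma R0_indic (c : R) A : P A -> R0 P (fun x => c * \1_A x) /\
  int_R0 P mu (fun x => c * \1_A x) = c * mu A.
Proof.
move=> PA.
have rep : represents P (fun _ : 'I_1 => c) (fun=> A) (fun x => c * \1_A x).
  by split=> // x; rewrite big_ord1.
by split; [exact: R0_lincomb rep|rewrite (int_R0E _ _ rep)// big_ord1].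
Qed.

Lemma int_R1_R0 phi : R0 P phi ->
  int_R1 P mu (EFin \o phi) = (int_R0 P mu phi)%:E.
Proof.
move=> R0phi; have phiphi : increases_to P mu (fun=> phi) (EFin \o phi).
  by apply: almost_everyW => // x; split=> //; exact: cvg_cst.
by rewrite -(cvg_lim _ (int_R1_cvg semP mu_fin (fun=> R0phi) phiphi))// lim_cst.
Qed.

End step_functions.

(** * The product semiring, its measure and the sections of rectangles *)

Section sections.
Variables (R : realType) (X Y : Type) (P : set (set X)) (Q : set (set Y)).
Variables (mu : set X -> R) (nu : set Y -> R).
Hypotheses (semP : set_semiring P) (semQ : set_semiring Q).
Hypotheses (mu_fin : finite_measure_on P mu) (nu_fin : finite_measure_on Q nu).
Local Notation PQ := (prod_family P Q).
Local Notation lam := (prod_measure mu nu).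

(** Removing [A' x B'] from [A x B] leaves the disjoint sets [(A \ A') x B] and
    [(A & A') x (B \ B')], and each difference of sides splits into pieces of its own semiring. *)
Lemma prod_family_semiring : set_semiring PQ.
Proof.
have [P0 PI PD] := semP; have [Q0 QI QD] := semQ; split.
- by exists set0 => //; exists set0 => //; rewrite setX0.
- move=> _ _ [A PA [B QB <-]] [A' PA' [B' QB' <-]].
  exists (A `&` A'); first exact: PI.
  by exists (B `&` B'); [exact: QI|rewrite setXI].
move=> _ _ [A PA [B QB <-]] [A' PA' [B' QB' <-]].
have [D [finD DP DE Dtriv]] := PD _ _ PA PA'.
have [D' [finD' D'Q D'E D'triv]] := QD _ _ QB QB'.
have AA' : P (A `&` A') by exact: PI.
exists ([set C `*` B | C in D] `|` [set (A `&` A') `*` C | C in D']); split.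
- by rewrite finite_setU; split; exact: finite_image.
- move=> _ [[C DC <-]|[C DC <-]].
    by exists C; [exact: DP|exists B].
  by exists (A `&` A') => //; exists C => //; exact: D'Q.
- apply/seteqP; split=> [[x y] [/= [Ax By] nA'B']|[x y]].
    have [A'x|A'x] := pselect (A' x); last first.
      have : (A `\` A') x by [].
      by rewrite DE => -[C DC Cx]; exists (C `*` B) => //; left; exists C.
    have : (B `\` B') y by split => // B'y; exact: nA'B'.
    rewrite D'E => -[C DC Cy]; exists ((A `&` A') `*` C) => //.
    by right; exists C.
  move=> [_ [[C DC <-]|[C DC <-]] [/= Cx Cy]].
    have : (A `\` A') x by rewrite DE; exists C.
    by move=> [Ax A'x]; split => // -[].
  have : (B `\` B') y by rewrite D'E; exists C.
  by move: Cx => [Ax A'x] [By B'y]; split => // -[].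
- have sep C E x : D C -> (A `&` A') x -> C x -> E.
    move=> DC [_ A'x] Cx; have : (A `\` A') x by rewrite DE; exists C.
    by case.
  move=> _ _ [[C DC <-]|[C DC <-]] [[C' DC' <-]|[C' DC' <-]]
    [[x y] [/= [Cx Cy] [C'x C'y]]].
  + by congr (_ `*` _); apply: Dtriv => //; exists x.
  + exact: sep DC C'x Cx.
  + exact: sep DC' Cx C'x.
  + by congr (_ `*` _); apply: D'triv => //; exists y.
Qed.

Definition section (E : set (X * Y)) x : set Y := [set y | E (x, y)].

Lemma section_setX A B x : section (A `*` B) x = if x \in A then B else set0.
Proof.
apply/seteqP; split=> y; rewrite /section /=.
  by move=> [Ax By]; rewrite mem_set.
by case: ifPn => // /set_mem.
Qed.

Lemma section_measurable E x : PQ E -> Q (section E x).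
Proof.
have [Q0 _ _] := semQ; move=> [A PA [B QB <-]].
by rewrite section_setX; case: ifP.
Qed.

Lemma measure_sectionE A B x : nu (section (A `*` B) x) = nu B * \1_A x.
Proof.
have [_ nu0 _] := nu_fin; rewrite section_setX indicE.
by case: ifP => _; rewrite (mulr1, mulr0).
Qed.

Let lamE A B : lam (A `*` B) = mu A * nu B.
Proof.
by have [_ mu0 _] := mu_fin; have [_ nu0 _] := nu_fin; exact: prod_measureE.
Qed.

(** Cavalieri's principle for a rectangle: the section over [x] is [B] or empty, according to
    whether [A] contains [x]. *)
Lemma measure_section_R0 E : PQ E -> R0 P (fun x => nu (section E x)) /\
  int_R0 P mu (fun x => nu (section E x)) = lam E.
Proof.
move=> [A PA [B QB <-]].
have -> : (fun x => nu (section (A `*` B) x)) = fun x => nu B * \1_A x.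
  by apply/funext => x; exact: measure_sectionE.
by rewrite lamE mulrC; exact: R0_indic.
Qed.

(* Countable additivity of the product: integrate over [X] the countable
   additivity of [nu] on the sections. *)
Lemma prod_measure_finite : finite_measure_on PQ lam.
Proof.
have [mu_ge0 mu0 _] := mu_fin; have [nu_ge0 nu0 nu_sigma] := nu_fin; split.
- by move=> _ [A PA [B QB <-]]; rewrite lamE mulr_ge0// ?mu_ge0 ?nu_ge0.
- by rewrite /prod_measure image_set0 mu0 mul0r.
move=> E PQE trivE PQUE.
pose phi n x := \sum_(0 <= i < n) nu (section (E i) x).
have R0phi n : R0 P (phi n).
  apply: (R0_sum semP mu_fin _ _).1 => i.
  by have [] := measure_section_R0 (PQE i).
have [R0U intU] := measure_section_R0 PQUE.
have phiU : increases_to P mu phi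
    (EFin \o (fun x => nu (section (\bigcup_n E n) x))).
  apply: almost_everyW => // x; split.
    move=> n; rewrite /phi big_nat_recr//= lerDl.
    exact/nu_ge0/section_measurable.
  apply: cvg_EFin; first exact: nearW.
  have secU : section (\bigcup_n E n) x = \bigcup_n section (E n) x by [].
  rewrite secU; apply: nu_sigma.
  - by move=> n; exact: section_measurable.
  - by move=> i j _ _ [y [Ei Ej]]; apply: trivE => //; exists (x, y).
  - by rewrite -secU; exact: section_measurable.
have lamphi n : \sum_(0 <= i < n) lam (E i) = int_R0 P mu (phi n).
  rewrite (R0_sum semP mu_fin n _).2; last first.
    by move=> i; have [] := measure_section_R0 (PQE i).
  by apply: eq_bigr => i _; have [_ ->] := measure_section_R0 (PQE i).
under eq_fun do rewrite lamphi.
(* The union is a rectangle, so the limit function is itself a step function and its integral is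
   [lam] of the union. *)
have := int_R1_cvg semP mu_fin R0phi phiU.
by rewrite int_R1_R0// intU => /fine_cvg.
Qed.

(** A representation of [phi] by rectangles [A i x B i] can be cut at [x] with the same
    coefficients; integrating over [Y] leaves the coefficient [c i * nu (B i)] on [A i], so both
    integrals are the same finite sum. *)
Lemma R0_section phi : R0 PQ phi ->
  [/\ forall x, R0 Q (fun y => phi (x, y)),
      R0 P (fun x => int_R0 Q nu (fun y => phi (x, y))) &
      int_R0 P mu (fun x => int_R0 Q nu (fun y => phi (x, y))) =
      int_R0 PQ lam phi].
Proof.
move=> [n [c [E [PQE phiE]]]].
have repx x : represents Q c (fun i => section (E i) x) (fun y => phi (x, y)).
  by split=> [i|y]; [exact: section_measurable|exact: phiE].
have /choice[A /choice[B EAB]] :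
    forall i, exists A B, [/\ P A, Q B & E i = A `*` B].
  by move=> i; have [A PA [B QB <-]] := PQE i; exists A, B.
have rep : represents P (fun i => c i * nu (B i)) A
    (fun x => int_R0 Q nu (fun y => phi (x, y))).
  split=> [i|x]; first by have [] := EAB i.
  rewrite (int_R0E semQ nu_fin (repx x)); apply: eq_bigr => i _.
  by have [_ _ ->] := EAB i; rewrite measure_sectionE mulrA.
split; first by move=> x; exact: R0_lincomb (repx x).
  exact: R0_lincomb rep.
rewrite (int_R0E semP mu_fin rep).
rewrite (int_R0E prod_family_semiring prod_measure_finite (conj PQE phiE)).
apply: eq_bigr => i _; have [_ _ ->] := EAB i.
by rewrite lamE -mulrA; congr (_ * _); rewrite mulrC.
Qed.

End sections.

(** * Sections of null sets, then Fubini on R1 and R2 *)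

Lemma sum_half_pow (R : realFieldType) m :
  \sum_(0 <= k < m) (2^-1 : R) ^+ k <= 2.
Proof.
suff -> : \sum_(0 <= k < m) (2^-1 : R) ^+ k = 2 - 2 * 2^-1 ^+ m.
  by rewrite gerBl mulr_ge0// exprn_ge0// invr_ge0.
elim: m => [|m IH]; first by rewrite big_nil expr0 mulr1 subrr.
by rewrite big_nat_recr//= IH exprS; lra.
Qed.

Section fubini.
Variables (R : realType) (X Y : Type) (P : set (set X)) (Q : set (set Y)).
Variables (mu : set X -> R) (nu : set Y -> R).
Hypotheses (semP : set_semiring P) (semQ : set_semiring Q).
Hypotheses (mu_fin : finite_measure_on P mu) (nu_fin : finite_measure_on Q nu).
Local Notation PQ := (prod_family P Q).
Local Notation lam := (prod_measure mu nu).
Let semPQ := prod_family_semiring semP semQ.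
Let lam_fin := prod_measure_finite semP semQ mu_fin nu_fin.

(* Borel-Cantelli: cover [N] by sequences [F k] of total measure < 2^-k; the
   section measures of all the [F k i] have an integrable sum, so for almost
   every [x] the sections of some [F k] have a total measure as small as we
   wish. *)
Lemma null_section N : null_on PQ lam N ->
  almost_every P mu (fun x => null_on Q nu (section N x)).
Proof.
move=> Nnull.
have [nu_ge0 _ _] := nu_fin; have [lam_ge0 _ _] := lam_fin.
have /choice[F FN] : forall k, exists F : nat -> set (X * Y),
    [/\ forall n, PQ (F n), N `<=` \bigcup_n F n &
      (\sum_(0 <= n <oo) (lam (F n))%:E < ((2^-1 : R) ^+ k)%:E)%E].
  by move=> k; apply: Nnull; rewrite exprn_gt0// invr_gt0.
have PQF k i : PQ (F k i) by have [] := FN k.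
pose a k i x := nu (section (F k i) x).
have a_ge0 k i x : 0 <= a k i x.
  by apply: nu_ge0; exact: section_measurable (PQF k i).
have aR0 k i : R0 P (a k i) /\ int_R0 P mu (a k i) = lam (F k i).
  by have := measure_section_R0 semP mu_fin nu_fin (PQF k i).
(* Truncating both indices at [m] makes the double series a single increasing sequence of step
   functions. *)
pose Phi m x := \sum_(0 <= i < m) \sum_(0 <= k < m) a k i x.
have sumR0 m i := R0_sum semP mu_fin m (fun k => (aR0 k i).1).
have R0Phi m : R0 P (Phi m).
  by apply: (R0_sum semP mu_fin _ _).1 => i; apply: (sumR0 m i).1.
(* The bound is the sum of all [2^-k]: after the exchange of sums, index [k] contributes at most
   [2^-k]. *)
have intPhi m : int_R0 P mu (Phi m) <= 2.
  rewrite (R0_sum semP mu_fin m (fun i => (sumR0 m i).1)).2.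
  apply: le_trans (sum_half_pow R m).
  rewrite (eq_bigr _ (fun i _ => (sumR0 m i).2)).
  rewrite exchange_big; apply: ler_sum => k _ /=.
  have [_ _ /ltW Fk] := FN k; rewrite -lee_fin; apply: le_trans Fk.
  rewrite -sumEFin (eq_bigr (fun i => (lam (F k i))%:E)).
    by apply: nneseries_lim_ge => i _ _; rewrite lee_fin lam_ge0.
  by move=> i _; rewrite (aR0 k i).2.
have le_sum2 m n m' n' x : (m <= m')%N -> (n <= n')%N ->
    \sum_(0 <= i < m) \sum_(0 <= k < n) a k i x <=
    \sum_(0 <= i < m') \sum_(0 <= k < n') a k i x.
  move=> mm' nn'; rewrite (big_cat_nat (leq0n m) mm')//= -[leLHS]addr0 lerD//.
    apply: ler_sum => i _.
    by rewrite (big_cat_nat (leq0n n) nn')//= lerDl sumr_ge0.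
  by rewrite sumr_ge0// => i _; rewrite sumr_ge0.
pose G x := limn (fun m => (Phi m x)%:E).
have PhiG x : (fun m => (Phi m x)%:E) @ \oo --> G x.
  apply: ereal_nondecreasing_is_cvgn => m n mn.
  by rewrite lee_fin; exact: le_sum2.
have incG : increases_to P mu Phi G.
  by apply: almost_everyW => // x; split=> // m; exact: le_sum2.
have Goo : (int_R1 P mu G < +oo)%E.
  apply: (@le_lt_trans _ _ 2%:E); last exact: ltry.
  have cvgG := int_R1_cvg semP mu_fin R0Phi incG.
  rewrite -(cvg_lim _ cvgG)//; apply: lime_le.
    by apply/cvg_ex; eexists; exact: cvgG.
  by apply: nearW => m; rewrite lee_fin.
have R1G : R1 P mu G by exists Phi.
apply: almost_everyS (R1_lty semP mu_fin R1G Goo) => x Gx e e0.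
suff [k Fk] : exists k, (\sum_(0 <= i <oo) (a k i x)%:E < e%:E)%E.
  exists (fun i => section (F k i) x); split => //.
    by move=> i; exact: section_measurable.
  by move=> y /= Ny; have [_ NF _] := FN k; have [i _ Fi] := NF _ Ny; exists i.
(* Otherwise each of the first [K] covers contributes at least [e] to [G x], for every [K], and
   [G x] is infinite. *)
apply: contrapT => /forallNP ge_e.
have PhileG m : ((Phi m x)%:E <= G x)%E.
  apply: lime_ge; first exact: PhiG.
  by exists m => // n /= mn; rewrite lee_fin; exact: le_sum2.
have KG K : ((e *+ K)%:E <= G x)%E.
  apply: (@le_trans _ _ (\sum_(0 <= k < K) \sum_(0 <= i <oo) (a k i x)%:E)%E).
    rewrite -[K in leLHS]subn0 -sumr_const_nat -sumEFin; apply: lee_sum => k _.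
    by rewrite leNgt; apply/negP/ge_e.
  rewrite -nneseries_sum_nat; last by move=> *; rewrite lee_fin.
  apply: lime_le.
    apply: is_cvg_nneseries => i _ _.
    by rewrite sume_ge0// => k _; rewrite lee_fin.
  (* The square of side [maxn m K] contains the [m] by [K] block of indices. *)
  apply: nearW => m; apply: le_trans (PhileG (maxn m K)).
  rewrite (eq_bigr (fun i => (\sum_(0 <= k < K) a k i x)%:E)); last first.
    by move=> i _; rewrite sumEFin.
  by rewrite sumEFin lee_fin; apply: le_sum2; rewrite leq_max leqnn ?orbT.
have G0 : (0 <= G x)%E by apply: le_trans (KG 0%N); rewrite mulr0n.
case Gr : (G x) Gx G0 => [r||]// _; rewrite lee_fin => r0.
(* By the Archimedean property [Num.bound (r / e)] exceeds [r / e], against [KG]. *)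
have := KG (Num.bound (r / e)); rewrite Gr lee_fin leNgt => /negP; apply.
rewrite -mulr_natr mulrC -ltr_pdivrMr//.
by apply: archi_boundP; rewrite divr_ge0// ltW.
Qed.

Lemma almost_every_section (Z : X * Y -> Prop) : almost_every PQ lam Z ->
  almost_every P mu (fun x => almost_every Q nu (fun y => Z (x, y))).
Proof.
move=> [N /null_section Nnull NZ]; apply: almost_everyS Nnull => x Nx.
by exists (section N x) => // y Ny; exact: NZ.
Qed.

Lemma fubini_R1 f : R1 PQ lam f ->
  [/\ almost_every P mu (fun x => R1 Q nu (fun y => f (x, y))),
      R1 P mu (fun x => int_R1 Q nu (fun y => f (x, y))) &
      int_R1 PQ lam f = int_R1 P mu (fun x => int_R1 Q nu (fun y => f (x, y)))].
Proof.
move=> [phi [R0phi phif]].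
have R0phix n x : R0 Q (fun y => phi n (x, y)).
  by have [] := R0_section semP semQ mu_fin nu_fin (R0phi n).
pose psi n x := int_R0 Q nu (fun y => phi n (x, y)).
have R0psi n : R0 P (psi n).
  by have [] := R0_section semP semQ mu_fin nu_fin (R0phi n).
have phifx := almost_every_section phif.
(* At exceptional [x] the inner [int_R1] may be the default value 0, which [increases_to]
   ignores. *)
have psif : increases_to P mu psi (fun x => int_R1 Q nu (fun y => f (x, y))).
  apply: almost_everyS phifx => x phifx; split.
    move=> n; apply: (le_int_R0 semQ nu_fin) => //.
    by apply: almost_everyS phifx => y [].
  exact: (@int_R1_cvg _ _ _ _ semQ nu_fin (fun n y => phi n (x, y))).
split.
- apply: almost_everyS phifx => x phifx.
  by exists (fun n y => phi n (x, y)).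
- by exists psi.
(* Both sides are limits of integrals of step functions, and these agree term by term by
   [R0_section]. *)
rewrite -(cvg_lim _ (int_R1_cvg semPQ lam_fin R0phi phif))//.
rewrite -(cvg_lim _ (int_R1_cvg semP mu_fin R0psi psif))//.
congr (limn _); apply/funext => n; congr (_%:E).
by have [] := R0_section semP semQ mu_fin nu_fin (R0phi n).
Qed.

(** For the finiteness clause: whichever double integral is finite is, by [fubini_R1], the integral
    of an inner integral, and the latter is therefore below [+oo] for almost every [x]. *)
Lemma fubini_difference f f1 f2 : difference_of PQ lam f f1 f2 ->
  almost_every P mu (fun x => difference_of Q nu (fun y => f (x, y))
    (fun y => f1 (x, y)) (fun y => f2 (x, y))).
Proof.
move=> [R1f1 R1f2 fin fE].
have [R1f1x R1g1 intg1] := fubini_R1 R1f1.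
have [R1f2x R1g2 intg2] := fubini_R1 R1f2.
have ltyfin h1 : R1 Q nu h1 -> (int_R1 Q nu h1 < +oo)%E ->
    int_R1 Q nu h1 \is a fin_num.
  by move=> R1h hoo; rewrite fin_numElt hoo int_R1_gtNy.
have gfin : almost_every P mu (fun x =>
    (int_R1 Q nu (fun y => f1 (x, y)) < +oo)%E \/
    (int_R1 Q nu (fun y => f2 (x, y)) < +oo)%E).
  case: fin => /fin_numPlt/andP[_]; rewrite (intg1, intg2) => goo.
    by apply: almost_everyS (R1_lty semP mu_fin R1g1 goo); left.
  by apply: almost_everyS (R1_lty semP mu_fin R1g2 goo); right.
have := almost_everyI semP mu_fin (almost_everyI semP mu_fin R1f1x R1f2x)
  (almost_everyI semP mu_fin gfin (almost_every_section fE)).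
apply: almost_everyS => x [[R1f1x' R1f2x'] [gfinx fEx]]; split => //.
by case: gfinx => ?; [left|right]; exact: ltyfin.
Qed.

End fubini.

Theorem theorem8p1 (R : realType) (X Y : Type)
    (P : set (set X)) (Q : set (set Y)) (mu : set X -> R) (nu : set Y -> R)
    (semP : set_semiring P) (semQ : set_semiring Q)
    (mu_fin : finite_measure_on P mu) (nu_fin : finite_measure_on Q nu)
    (f : X * Y -> \bar R)
    (fR2 : R2 (prod_family P Q) (prod_measure mu nu) f) :
  [/\ almost_every P mu (fun x => R2 Q nu (fun y => f (x, y))),
      R2 P mu (fun x => int_R2 Q nu (fun y => f (x, y))) &
      int_R2 (prod_family P Q) (prod_measure mu nu) f =
      int_R2 P mu (fun x => int_R2 Q nu (fun y => f (x, y)))].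
Proof.
have [f1 [f2 fE]] := fR2.
have fxE := fubini_difference semP semQ mu_fin nu_fin fE.
have [R1f1 R1f2 fin _] := fE.
have [_ R1g1 intg1] := fubini_R1 semP semQ mu_fin nu_fin R1f1.
have [_ R1g2 intg2] := fubini_R1 semP semQ mu_fin nu_fin R1f2.
(* The inner integrals of [f1] and [f2] exhibit that of [f] as a member of R2 over [X]; the
   finiteness clause carries over by [fubini_R1]. *)
have gE : difference_of P mu (fun x => int_R2 Q nu (fun y => f (x, y)))
    (fun x => int_R1 Q nu (fun y => f1 (x, y)))
    (fun x => int_R1 Q nu (fun y => f2 (x, y))).
  split=> //; first by rewrite -intg1 -intg2.
  by apply: almost_everyS fxE => x fxE; exact: int_R2E.
split.
- by apply: almost_everyS fxE => x fxE; do 2 eexists; exact: fxE.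
- by do 2 eexists; exact: gE.
(* Both sides equal the difference of the integrals of [f1] and [f2] over the product. *)
rewrite (int_R2E semP mu_fin gE) -intg1 -intg2.
apply: int_R2E fE; first exact: prod_family_semiring.
exact: prod_measure_finite.
Qed.
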